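(* Let $R$ be a commutative ring, $X=\operatorname{Spec} R$, considered in the surjective topology. Then the fixation given by the natural homomorphism $R\to\operatorname{rad}(R):=\prod_{x\in\operatorname{Spec} R}\overline{\kappa(x)}$ defines an absolute filter, and $\operatorname{rad}(R)$ is the corresponding absolute stalk (of the structure sheaf).
   Context: Here $\overline{\kappa(x)}$ is an algebraic closure of the residue field at $x$, and $R\to\operatorname{rad}(R)$ is induced by the maps $R\to\kappa(x)\to\overline{\kappa(x)}$. Surjective topology on $X$: the category $\mathcal T_X$ is the full subcategory of schemes of finite type which are affine over $X$; the coverings (covers) are the single morphisms $V\to U$ over $X$ which are affine, surjective and of finite type. $\mathcal O_{\mathrm{surj}}$ is the sheafification of the presheaf $\operatorname{Spec} S\mapsto S$. A small category $\Lambda$ with a final object is quasicofiltered if for every pair $\lambda\to\mu$, $\lambda'\to\mu$ there are $\kappa$ and $\kappa\to\lambda$, $\kappa\to\lambda'$ with equal compositions to $\mu$; it is cofiltered if moreover for every pair of arrows $\psi_1,\psi_2:\lambda\rightrightarrows\mu$ there is $\varphi:\kappa\to\lambda$ with $\psi_1\varphi=\psi_2\varphi$. A quasifilter (resp. filter) in $\mathcal T_X$ is a covariant functor $F:\Lambda\to\mathcal T_X$, $\lambda\mapsto U_\lambda$, respecting the final object, with $\Lambda$ quasicofiltered (resp. cofiltered). The stalk of a presheaf $P$ in $F$ is $\varinjlim_{\lambda\in\Lambda}\Gamma(U_\lambda,P)$. The quasifilter defined by a scheme morphism $Z\to X$ (a fixation): the index category has as objects the (isomorphism types of) factorizations $Z\to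 U\to X$ with $U\to X$ in $\mathcal T_X$, as morphisms the morphisms $U\to U'$ in $\mathcal T_X$ commuting with the maps from $Z$; the functor sends $(Z\to U\to X)$ to $U$. A fixation by a ring homomorphism $R\to H$ means $Z=\operatorname{Spec} H$. A (quasi)filter $F:\Lambda\to\mathcal T_X$ is absolute if every $U_\lambda\to X$ is a cover and if for every $\lambda\in\Lambda$ and every cover $Y\to U_\lambda$ in $\mathcal T_X$ there exist $\kappa\in\Lambda$ and a factorization $U_\kappa\to Y\to U_\lambda$ whose composition comes from an arrow $\kappa\to\lambda$ in $\Lambda$. A stalk in an absolute filter is called an absolute stalk; the claim means that $\varinjlim_\lambda\Gamma(U_\lambda,\mathcal O_{\mathrm{surj}})\cong\operatorname{rad}(R)$ for the filter given by $R\to\operatorname{rad}(R)$. *)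

(* Defs.v *)
From HB Require Import structures.
From mathcomp Require Import all_boot all_algebra.
From mathcomp Require Import boolp.

Set Implicit Arguments.
Unset Strict Implicit.
Unset Printing Implicit Defensive.

Import GRing.Theory.
Local Open Scope ring_scope.
Local Open Scope quotient_scope.

Record category := Category {
  obj :> Type;
  mor : obj -> obj -> Type;
  idm : forall a, mor a a;
  cmp : forall x y z, mor y z -> mor x y -> mor x z;
  cmp1m : forall a b (f : mor a b), cmp (idm b) f = f;
  cmpm1 : forall a b (f : mor a b), cmp f (idm a) = f;
  cmpA : forall a b c d (f : mor c d) (g : mor b c) (h : mor a b),
    cmp f (cmp g h) = cmp (cmp f g) h }.

Arguments mor {_} _ _.
Arguments idm {_} a.
Arguments cmp {_ x y z} _ _.

Notation "f \oc g" := (cmp f g) (at level 50, left associativity).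

Record functor (C D : category) := Functor {
  fobj :> C -> D;
  fmap : forall a b : C, mor a b -> mor (fobj a) (fobj b);
  fmap1 : forall a, fmap (idm a) = idm (fobj a);
  fmapM : forall a b c (f : mor b c) (g : mor a b),
    fmap (f \oc g) = fmap f \oc fmap g }.

Arguments fmap {C D} _ {a b} _.

Record nat_trans (C D : category) (F G : functor C D) := NatTrans {
  ntc :> forall a : C, mor (F a) (G a);
  ntc_nat : forall (a b : C) (f : mor a b),
    fmap G f \oc ntc a = ntc b \oc fmap F f }.

Definition opposite (C : category) : category :=
  @Category C (fun a b => mor b a) (@idm C) (fun a b c f g => g \oc f)
    (fun a b f => cmpm1 f) (fun a b f => cmp1m f)
    (fun a b c d f g h => esym (cmpA h g f)).

Definition opposite_functor (C D : category) (F : functor C D) :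
    functor (opposite C) (opposite D) :=
  @Functor (opposite C) (opposite D) F (fun a b f => fmap F (f : @mor C b a))
    (fmap1 F) (fun a b c f g => fmapM F g f).

Section FunctorComp.
Variables (C D E : category) (G : functor D E) (F : functor C D).

Lemma comp_fmap1 a : fmap G (fmap F (idm a)) = idm (G (F a)).
Proof. by rewrite !fmap1. Qed.

Lemma comp_fmapM a b c (f : @mor C b c) (g : mor a b) :
  fmap G (fmap F (f \oc g)) = fmap G (fmap F f) \oc fmap G (fmap F g).
Proof. by rewrite !fmapM. Qed.

Definition functor_comp : functor C E :=
  @Functor C E (fun a => G (F a)) (fun a b f => fmap G (fmap F f))
    comp_fmap1 comp_fmapM.

End FunctorComp.

Section FullSub.
Variables (C : category) (P : C -> Prop).

Definition full_sub : category :=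
  @Category {a : C | P a} (fun a b => mor (sval a) (sval b))
    (fun a => idm (sval a)) (fun a b c f g => f \oc g)
    (fun a b f => cmp1m f) (fun a b f => cmpm1 f)
    (fun a b c d f g h => cmpA f g h).

Definition full_incl : functor full_sub C :=
  @Functor full_sub C (fun a => sval a) (fun a b f => f)
    (fun a => erefl) (fun a b c f g => erefl).

End FullSub.

Section Under.
Variables (T C : category) (I : functor T C) (Z : C).

Record under := Under { under_obj :> T; under_map : mor Z (I under_obj) }.

Definition under_hom (u v : under) :=
  {f : mor u v | fmap I f \oc under_map u = under_map v}.

Lemma under_hom_inj (u v : under) (f g : under_hom u v) :
  sval f = sval g -> f = g.
Proof. by case: f g => [f p] [g q] /= fg; exact: eq_exist. Qed.

Lemma under_id_subproof (u : under) :
  fmap I (idm (u : T)) \oc under_map u = under_map u.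
Proof. by rewrite fmap1 cmp1m. Qed.

Definition under_id (u : under) : under_hom u u := exist _ _ (under_id_subproof u).

Lemma under_comp_subproof (u v w : under) (f : under_hom v w)
    (g : under_hom u v) :
  fmap I (sval f \oc sval g) \oc under_map u = under_map w.
Proof. by rewrite fmapM -cmpA (svalP g) (svalP f). Qed.

Definition under_comp (u v w : under) (f : under_hom v w) (g : under_hom u v) :
  under_hom u w := exist _ _ (under_comp_subproof f g).

Definition under_category : category.
Proof.
apply: (@Category under under_hom under_id under_comp).
- by move=> u v f; apply: under_hom_inj; rewrite /= cmp1m.
- by move=> u v f; apply: under_hom_inj; rewrite /= cmpm1.
- by move=> t u v w f g h; apply: under_hom_inj; rewrite /= cmpA.
Defined.

Definition under_functor : functor under_category T :=
  @Functor under_category T under_obj (fun a b f => sval f)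
    (fun a => erefl) (fun a b c f g => erefl).

End Under.

Definition is_final (C : category) (t : C) : Prop :=
  forall a : C, exists! f : mor a t, True.

Definition quasicofiltered (L : category) : Prop :=
  (exists t : L, is_final t) /\
  forall (l l' m : L) (f : mor l m) (f' : mor l' m),
    exists (k : L) (g : mor k l) (g' : mor k l'), f \oc g = f' \oc g'.

Definition cofiltered (L : category) : Prop :=
  quasicofiltered L /\
  forall (l m : L) (f1 f2 : mor l m),
    exists (k : L) (g : mor k l), f1 \oc g = f2 \oc g.

Section Colimit.
Variables (J C : category) (D : functor J C).

Record cocone (c : C) := Cocone {
  leg :> forall j : J, mor (D j) c;
  leg_compat : forall (i j : J) (f : mor i j), leg j \oc fmap D f = leg i }.

Definition is_colimit (c : C) (p : cocone c) : Prop :=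
  forall (d : C) (q : cocone d),
    exists! h : mor c d, forall j : J, h \oc p j = q j.

End Colimit.

Lemma rmorphism_ext (R S : pzSemiRingType) (f g : {rmorphism R -> S}) :
  f =1 g -> f = g.
Proof.
case: f g => [f cf] [g cg] /= fg.
have {}fg : f = g by apply: funext.
subst g; congr (GRing.RMorphism.Pack _).
case: cf cg => [[a1] [b1]] [[a2] [b2]].
by rewrite (Prop_irrelevance a1 a2) (Prop_irrelevance b1 b2).
Qed.

Definition rmorph_comp (R S T : pzSemiRingType) (f : {rmorphism S -> T})
  (g : {rmorphism R -> S}) : {rmorphism R -> T} := f \o g.

Definition rmorph_id (R : pzSemiRingType) : {rmorphism R -> R} := @idfun R.

Definition CRing : category.
Proof.
apply: (@Category comPzRingType (fun R S => {rmorphism R -> S})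
  (fun R => rmorph_id R) (fun R S T f g => rmorph_comp f g)).
- by move=> R S f; apply: rmorphism_ext.
- by move=> R S f; apply: rmorphism_ext.
- by move=> R S T U f g h; apply: rmorphism_ext.
Defined.

(* S is the smallest subring containing f(R) and finitely many elements;
   closure under opposites follows from -1 being in f(R). *)
Definition finite_type (R S : comPzRingType) (f : {rmorphism R -> S}) : Prop :=
  exists s : seq S, forall P : S -> Prop,
    (forall a, P (f a)) -> (forall y, y \in s -> P y) ->
    (forall y z, P y -> P z -> P (y + z)) ->
    (forall y z, P y -> P z -> P (y * z)) ->
    forall y, P y.

(* R may be the zero ring, where prime_idealr is not available. *)
Definition is_prime (R : comPzRingType) (I : {pred R}) : Prop :=
  [/\ 0 \in I, 1 \notin I,
      forall a, {in I &, forall u v, a * u + v \in I} &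
      forall u v, u * v \in I -> (u \in I) || (v \in I)].

Record spec (R : comPzRingType) := Spec {
  spec_pred :> {pred R};
  spec_prime : is_prime spec_pred }.

Lemma is_prime_preim (R S : comPzRingType) (f : {rmorphism R -> S})
  (q : spec S) : is_prime [pred a | f a \in (q : {pred S})].
Proof.
case: (spec_prime q) => q0 q1 qD qM; split; rewrite ?inE ?rmorph0 ?rmorph1 //.
- by move=> a u v; rewrite !inE rmorphD rmorphM => uq vq; exact: qD.
- by move=> u v; rewrite !inE rmorphM => /qM.
Qed.

Definition spec_map (R S : comPzRingType) (f : {rmorphism R -> S})
  (q : spec S) : spec R := Spec (is_prime_preim f q).

(* A copy of R that carries the information 1 != 0, read off from the
   existence of the prime x, so that the quotient by x can be formed. *)
Definition nzring (R : comPzRingType) (x : spec R) : Type := R.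

Section ResidueField.
Variables (R : comPzRingType) (x : spec R).

HB.instance Definition _ := GRing.ComPzRing.on (nzring x).

Lemma nzring_oner_neq0 : (1 : nzring x) != 0.
Proof.
by case: (spec_prime x) => x0 x1 _ _; apply: contraNneq x1 => ->.
Qed.

HB.instance Definition _ :=
  GRing.PzSemiRing_isNonZero.Build (nzring x) nzring_oner_neq0.

Definition nzspec : nzring x -> bool := fun a => a \in (x : {pred R}).

Lemma nzspec_idealr : idealr_closed nzspec.
Proof. by case: (spec_prime x) => x0 x1 xD _; split. Qed.

Lemma nzspec_prime : prime_idealr_closed nzspec.
Proof. by case: (spec_prime x). Qed.

HB.instance Definition _ := isIdealr.Build (nzring x) nzspec nzspec_idealr.
HB.instance Definition _ :=
  isPrimeIdealrClosed.Build (nzring x) nzspec nzspec_prime.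

Definition spec_ideal : prime_idealr (nzring x) := nzspec.

Definition quotient_domain : Type := {ideal_quot spec_ideal}.

HB.instance Definition _ := GRing.ComNzRing.on quotient_domain.

Definition qd_unit : pred quotient_domain := fun a => `[< exists b, b * a = 1 >].

Definition qd_inv (a : quotient_domain) : quotient_domain :=
  if pselect (exists b, b * a = 1) is left e then projT1 (cid e) else a.

Lemma qd_mulVr : {in qd_unit, left_inverse 1 qd_inv *%R}.
Proof.
move=> a /asboolP ua; rewrite /qd_inv; case: pselect => // e.
exact: (projT2 (cid e)).
Qed.

Lemma qd_unitP a b : b * a = 1 -> qd_unit a.
Proof. by move=> ba; apply/asboolP; exists b. Qed.

Lemma qd_inv_out : {in [predC qd_unit], qd_inv =1 id}.
Proof.
move=> a /negP na; rewrite /qd_inv; case: pselect => // e.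
by case: na; apply/asboolP.
Qed.

HB.instance Definition _ := GRing.ComNzRing_hasMulInverse.Build quotient_domain
  qd_mulVr qd_unitP qd_inv_out.

HB.instance Definition _ := GRing.ComUnitRing_isIntegral.Build quotient_domain
  (@Quotient.rquot_IdomainAxiom (nzring x) spec_ideal).

Definition residue_field : fieldType := {fraction quotient_domain}.

Definition residue_fun (a : R) : residue_field :=
  @FracField.tofrac quotient_domain (\pi_{ideal_quot spec_ideal} (a : nzring x)).

Lemma residue_fun_zmod : zmod_morphism residue_fun.
Proof. by move=> a b; rewrite /residue_fun -tofracB -rmorphB. Qed.

Lemma residue_fun_monoid : monoid_morphism residue_fun.
Proof.
split; first by rewrite /residue_fun -tofrac1 -(rmorph1 \pi_{ideal_quot spec_ideal}).
by move=> a b; rewrite /residue_fun -tofracM -rmorphM.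
Qed.

HB.instance Definition _ :=
  GRing.isZmodMorphism.Build R residue_field residue_fun residue_fun_zmod.
HB.instance Definition _ :=
  GRing.isMonoidMorphism.Build R residue_field residue_fun residue_fun_monoid.

Definition residue_map : {rmorphism R -> residue_field} := residue_fun.

End ResidueField.

Record alg_closure (k : fieldType) := AlgClosure {
  acl_field :> fieldType;
  acl_map : {rmorphism k -> acl_field};
  acl_closed : GRing.closed_field_axiom acl_field;
  acl_algebraic : forall z : acl_field, algebraicOver acl_map z }.

Section Product.
Variables (I : Type) (A : I -> comPzRingType).

Definition prod_ring : Type := forall i, A i.

HB.instance Definition _ := Choice.on prod_ring.

Implicit Types f g h : prod_ring.

Definition prod_zero : prod_ring := fun i => 0.
Definition prod_one : prod_ring := fun i => 1.
Definition prod_opp f : prod_ring := fun i => - f i.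
Definition prod_add f g : prod_ring := fun i => f i + g i.
Definition prod_mul f g : prod_ring := fun i => f i * g i.

Lemma prod_addA : associative prod_add.
Proof. by move=> f g h; apply: functional_extensionality_dep => i; exact: addrA. Qed.
Lemma prod_addC : commutative prod_add.
Proof. by move=> f g; apply: functional_extensionality_dep => i; exact: addrC. Qed.
Lemma prod_add0 : left_id prod_zero prod_add.
Proof. by move=> f; apply: functional_extensionality_dep => i; exact: add0r. Qed.
Lemma prod_addN : left_inverse prod_zero prod_opp prod_add.
Proof. by move=> f; apply: functional_extensionality_dep => i; exact: addNr. Qed.
Lemma prod_mulA : associative prod_mul.
Proof. by move=> f g h; apply: functional_extensionality_dep => i; exact: mulrA. Qed.
Lemma prod_mulC : commutative prod_mul.
Proof. by move=> f g; apply: functional_extensionality_dep => i; exact: mulrC. Qed.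
Lemma prod_mul1 : left_id prod_one prod_mul.
Proof. by move=> f; apply: functional_extensionality_dep => i; exact: mul1r. Qed.
Lemma prod_mulD : left_distributive prod_mul prod_add.
Proof. by move=> f g h; apply: functional_extensionality_dep => i; exact: mulrDl. Qed.

HB.instance Definition _ := GRing.isZmodule.Build prod_ring
  prod_addA prod_addC prod_add0 prod_addN.
HB.instance Definition _ := GRing.Zmodule_isComPzRing.Build prod_ring
  prod_mulA prod_mulC prod_mul1 prod_mulD.

Variables (R : comPzRingType) (u : forall i, {rmorphism R -> A i}).

Definition prod_fun (a : R) : prod_ring := fun i => u i a.

Lemma prod_fun_zmod : zmod_morphism prod_fun.
Proof. by move=> a b; apply: functional_extensionality_dep => i; exact: rmorphB. Qed.

Lemma prod_fun_monoid : monoid_morphism prod_fun.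
Proof.
split; first by apply: functional_extensionality_dep => i; exact: rmorph1.
by move=> a b; apply: functional_extensionality_dep => i; exact: rmorphM.
Qed.

HB.instance Definition _ :=
  GRing.isZmodMorphism.Build R prod_ring prod_fun prod_fun_zmod.
HB.instance Definition _ :=
  GRing.isMonoidMorphism.Build R prod_ring prod_fun prod_fun_monoid.

Definition prod_map : {rmorphism R -> prod_ring} := prod_fun.

End Product.

Section Rad.
Variables (R : comPzRingType) (K : forall x : spec R, alg_closure (residue_field x)).

Definition radR : comPzRingType := prod_ring (fun x : spec R => K x : comPzRingType).

Definition radR_map : {rmorphism R -> radR} :=
  prod_map (fun x => rmorph_comp (acl_map (K x)) (residue_map x)).

End Rad.

(* An affine scheme over Spec R is given by an R-algebra, and a morphism
   Spec S -> Spec T over Spec R by an R-algebra morphism T -> S. *)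

Record ralg (R : comPzRingType) := Alg {
  alg_ring :> comPzRingType;
  alg_str : {rmorphism R -> alg_ring} }.

Section Surjective.
Variable R : comPzRingType.

Record alg_hom (S T : ralg R) := AlgHom {
  alg_fun :> {rmorphism S -> T};
  alg_fun_str : forall a, alg_fun (alg_str S a) = alg_str T a }.

Lemma alg_hom_ext (S T : ralg R) (f g : alg_hom S T) : f =1 g -> f = g.
Proof.
case: f g => [f pf] [g pg] /= fg.
have {}fg := rmorphism_ext fg; subst g.
by congr AlgHom; exact: Prop_irrelevance.
Qed.

Definition alg_id (S : ralg R) : alg_hom S S :=
  @AlgHom S S (rmorph_id S) (fun a => erefl).

Lemma alg_comp_str (S T U : ralg R) (f : alg_hom T U) (g : alg_hom S T) a :
  rmorph_comp f g (alg_str S a) = alg_str U a.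
Proof. by rewrite /= !alg_fun_str. Qed.

Definition alg_comp (S T U : ralg R) (f : alg_hom T U) (g : alg_hom S T) :
  alg_hom S U := AlgHom (alg_comp_str f g).

Definition Alg_category : category.
Proof.
apply: (@Category (ralg R) alg_hom alg_id alg_comp).
- by move=> S T f; apply: alg_hom_ext.
- by move=> S T f; apply: alg_hom_ext.
- by move=> S T U V f g h; apply: alg_hom_ext.
Defined.

Definition AffX : category := opposite Alg_category.

Definition TX : category := full_sub (fun S : AffX => finite_type (alg_str S)).

Definition ring_of (U : TX) : comPzRingType := sval U.

Definition comorphism (U V : TX) (f : mor U V) :
  {rmorphism ring_of V -> ring_of U} := alg_fun f.

Definition structure_presheaf : functor (opposite TX) CRing :=
  @Functor (opposite TX) CRing ring_of (fun V U f => comorphism f)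
    (fun a => erefl) (fun a b c f g => erefl).

Lemma base_finite_type : finite_type (alg_str (Alg (rmorph_id R))).
Proof. by exists [::] => P PR _ _ _ y; exact: PR. Qed.

Definition baseX : TX := exist _ (Alg (rmorph_id R)) base_finite_type.

Definition to_baseX (U : TX) : mor U baseX :=
  @AlgHom (Alg (rmorph_id R)) (sval U) (alg_str (sval U)) (fun a => erefl).

(* A morphism in TX is automatically affine: source and target are affine
   schemes. *)
Definition surj_cover (V U : TX) (f : mor V U) : Prop :=
  finite_type (comorphism f) /\
  forall p : spec (ring_of U), exists q : spec (ring_of V),
    spec_map (comorphism f) q = p.

Definition presheaf := functor (opposite TX) CRing.

Definition restr (P : presheaf) (U V : TX) (f : mor V U) :
  {rmorphism (P U : comPzRingType) -> (P V : comPzRingType)} := fmap P f.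

Definition component (P Q : presheaf) (u : nat_trans P Q) (U : TX) :
  {rmorphism (P U : comPzRingType) -> (Q U : comPzRingType)} := u U.

(* The coverings being single morphisms V -> U, the two projections of
   V x_U V are replaced by all pairs of morphisms W -> V equalized by V -> U. *)
Definition is_sheaf (P : presheaf) : Prop :=
  forall (U V : TX) (f : mor V U), surj_cover f ->
  forall t : P V : comPzRingType,
    (forall (W : TX) (g h : mor W V), f \oc g = f \oc h ->
       restr P g t = restr P h t) ->
    exists! s : P U : comPzRingType, restr P f s = t.

(* Sheafification by its universal property among sheaves of rings. *)
Definition is_sheafification (P F : presheaf) (eta : nat_trans P F) : Prop :=
  is_sheaf F /\
  forall (G : presheaf) (u : nat_trans P G), is_sheaf G ->
    (exists v : nat_trans F G,
       forall U s, component v U (component eta U s) = component u U s) /\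
    (forall v w : nat_trans F G,
       (forall U s, component v U (component eta U s) = component w U (component eta U s)) ->
       forall U s, component v U s = component w U s).

Definition respects_final (L : category) (F : functor L TX) : Prop :=
  forall t : L, is_final t -> is_final (F t).

Definition is_quasifilter (L : category) (F : functor L TX) : Prop :=
  quasicofiltered L /\ respects_final F.

Definition is_filter (L : category) (F : functor L TX) : Prop :=
  cofiltered L /\ respects_final F.

Definition is_absolute (L : category) (F : functor L TX) : Prop :=
  (forall l : L, surj_cover (to_baseX (F l))) /\
  forall (l : L) (Y : TX) (f : mor Y (F l)), surj_cover f ->
    exists (k : L) (g : mor (F k) Y) (a : mor k l), f \oc g = fmap F a.

Definition stalk_diagram (L : category) (F : functor L TX) (P : presheaf) :
  functor (opposite L) CRing := functor_comp P (opposite_functor F).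

Definition is_stalk (L : category) (F : functor L TX) (P : presheaf)
    (A : comPzRingType) (p : cocone (stalk_diagram F P) A) : Prop :=
  is_colimit p.

Definition stalk_map (L : category) (F : functor L TX) (P : presheaf)
    (A : comPzRingType) (p : cocone (stalk_diagram F P) A) (l : L) :
  {rmorphism (P (F l) : comPzRingType) -> A} := p l.

(* An object is a factorization Z -> U -> Spec R with U in TX; the composition
   is the given Z -> Spec R because Z -> U is a morphism over Spec R. Isomorphic factorizations are not
   identified: the index category is equivalent to a small one, and neither the
   (co)filter conditions nor the colimit depend on the representatives. *)
Definition fixation_index (Z : AffX) : category :=
  under_category (full_incl (fun S : AffX => finite_type (alg_str S))) Z.

Definition fixation (Z : AffX) : functor (fixation_index Z) TX :=
  under_functor (full_incl (fun S : AffX => finite_type (alg_str S))) Z.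

(* The homomorphism S -> H belonging to Spec H -> Spec S -> Spec R. *)
Definition fixation_map (Z : AffX) (l : fixation_index Z) :
  {rmorphism ring_of (fixation Z l) -> (Z : ralg R)} :=
  alg_fun (under_map l : alg_hom (sval (under_obj l)) Z).

End Surjective.

(* Main.v *)
From HB Require Import structures.
Require Import Defs.
From mathcomp Require Import all_boot all_algebra.
From mathcomp Require Import boolp.

(* Write H = rad(R). A cover S -> T splits over H: given S -> H, the factor
   S -> K_x has a kernel p, some prime q of T lies over p, and since T/q is of
   finite type over S/p and K_x is algebraically closed, S/p -> K_x extends to
   T/q. Hence the fixation is absolute; it is a filter because any two
   S, S' -> H of finite type factor through the R-subalgebra of H that their
   images generate, on which equality can be tested in H.

   Only the universal property of the sheafification O is available, so it is
   applied to two sheaves. Mapping O to the sheaf S |-> H^Hom(S, H) produces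
   germs O(S) -> H at every point S -> H. Mapping O to its subsheaf of sections
   that, near every point S -> H, come from the structure presheaf shows that
   this subsheaf is all of O. So the stalk of O is the stalk of the structure
   presheaf, which is H, the union of its finitely generated subalgebras. *)

Set Implicit Arguments.
Unset Strict Implicit.
Unset Printing Implicit Defensive.

Import GRing.Theory.
Local Open Scope ring_scope.
Local Open Scope quotient_scope.

(** * Extension of homomorphisms into algebraically closed fields *)

(** The universal property of a quotient, for an arbitrary surjection: it serves for [proj_domain]
    as well as for a structure map that happens to be onto. *)
Lemma rmorphism_factor (A B C : comPzRingType) (p : {rmorphism A -> B})
    (g : {rmorphism A -> C}) :
  (forall b, exists a, p a = b) -> (forall a, p a = 0 -> g a = 0) ->
  exists h : {rmorphism B -> C}, forall a, h (p a) = g a.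
Proof.
move=> psurj pg; pose h b := g (sval (cid (psurj b))).
have hE a : h (p a) = g a.
  rewrite /h; case: cid => a' /= pa'.
  by apply/eqP; rewrite -subr_eq0 -rmorphB pg // rmorphB pa' subrr.
have hB : zmod_morphism h.
  move=> x y; have [a <-] := psurj x; have [b <-] := psurj y.
  by rewrite -rmorphB !hE rmorphB.
have hM : monoid_morphism h.
  split; first by rewrite -(rmorph1 p) hE rmorph1.
  move=> x y; have [a <-] := psurj x; have [b <-] := psurj y.
  by rewrite -rmorphM !hE rmorphM.
pose hz := GRing.isZmodMorphism.Build _ _ _ hB.
pose hm := GRing.isMonoidMorphism.Build _ _ _ hM.
pose H : {rmorphism B -> C} := HB.pack h hz hm.
by exists H.
Qed.

Definition proj_domain (R : comPzRingType) (x : spec R) : R -> quotient_domain x :=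
  fun a => \pi_{ideal_quot spec_ideal x} (a : nzring x).

Section ProjDomain.
Variables (R : comPzRingType) (x : spec R).

Lemma proj_domain_zmod : zmod_morphism (proj_domain x).
Proof. by move=> a b; rewrite /proj_domain -rmorphB. Qed.

Lemma proj_domain_monoid : monoid_morphism (proj_domain x).
Proof.
split; first exact: (rmorph1 \pi_{ideal_quot spec_ideal x}).
by move=> a b; rewrite /proj_domain -rmorphM.
Qed.

HB.instance Definition _ :=
  GRing.isZmodMorphism.Build R (quotient_domain x) (proj_domain x) proj_domain_zmod.
HB.instance Definition _ :=
  GRing.isMonoidMorphism.Build R (quotient_domain x) (proj_domain x)
    proj_domain_monoid.

Lemma proj_domain_surj b : exists a, proj_domain x a = b.
Proof. by exists (repr b); rewrite /proj_domain reprK. Qed.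

Lemma proj_domain_eq0 a : (proj_domain x a == 0) = (a \in (x : {pred R})).
Proof.
rewrite /proj_domain -(rmorph0 \pi_{ideal_quot spec_ideal x}) -Quotient.idealrBE.
by rewrite subr0.
Qed.

End ProjDomain.

Lemma spec_ext (R : comPzRingType) (x y : spec R) :
  (forall a, (a \in (x : {pred R})) = (a \in (y : {pred R}))) -> x = y.
Proof.
case: x y => [x px] [y py] /= xy.
have e : x = y by apply: funext => a; exact: (xy a).
by subst y; congr Spec; exact: Prop_irrelevance.
Qed.

Lemma kernel_is_prime (R : comPzRingType) (B : idomainType)
  (f : {rmorphism R -> B}) : is_prime [pred a | f a == 0].
Proof.
split; rewrite ?inE ?rmorph0 ?rmorph1 ?eqxx ?oner_eq0 //.
  move=> a u v; rewrite !inE rmorphD rmorphM => /eqP-> /eqP->.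
  by rewrite mulr0 addr0.
by move=> u v; rewrite !inE rmorphM mulf_eq0.
Qed.

Definition kernel_spec (R : comPzRingType) (B : idomainType)
  (f : {rmorphism R -> B}) : spec R := Spec (kernel_is_prime f).

Lemma closed_field_root (F : fieldType) (p : {poly F}) :
  GRing.closed_field_axiom F -> (1 < size p)%N -> exists x, p.[x] = 0.
Proof.
move=> Fclosed p1; have p0 : lead_coef p != 0.
  by rewrite lead_coef_eq0 -size_poly_gt0 ltnW.
have n0 : (0 < (size p).-1)%N by rewrite -subn1 subn_gt0.
(* The axiom solves equations x^n = sum of c_i x^i with i < n, so [p] is made monic and its lower
   terms are moved to the right-hand side. *)
have [x xE] := Fclosed _ (fun i => - p`_i / lead_coef p) n0.
exists x; rewrite horner_coef -(prednK (ltnW p1)) big_ord_recr /= xE.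
rewrite mulr_sumr -big_split /= big1 // => i _.
by rewrite -lead_coefE mulrA mulrCA divff // mulr1 mulNr subrr.
Qed.

(** For nonconstant [p], a root of [p + 1] is a point where [p] takes the value -1. *)
Lemma closed_field_nonroot (F : fieldType) (p : {poly F}) :
  GRing.closed_field_axiom F -> p != 0 -> exists x, p.[x] != 0.
Proof.
move=> Fclosed p0; have [p1|p1] := leqP (size p) 1.
  by exists 0; rewrite (size1_polyC p1) hornerC -polyC_eq0 -(size1_polyC p1).
have [|x] := @closed_field_root F (p + 1) Fclosed.
  by rewrite size_polyDl // size_poly1.
move=> /eqP; rewrite hornerD hornerC addr_eq0 => /eqP px.
by exists x; rewrite px oppr_eq0 oner_eq0.
Qed.

(* Either y is transcendental over A, or w is taken to be a root of an
   annihilator P of y of least degree, coprime to b. *)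
Lemma extend_step (A B : idomainType) (f : {rmorphism A -> B}) (y : B)
    (b : {poly A}) :
  injective f -> (map_poly f b).[y] != 0 ->
  exists2 a, a != 0 & forall (F : fieldType) (phi : {rmorphism A -> F}),
    GRing.closed_field_axiom F -> phi a != 0 ->
    exists w, (map_poly phi b).[w] != 0 /\
      forall h, (map_poly f h).[y] = 0 -> (map_poly phi h).[w] = 0.
Proof.
move=> finj by0; pose root h := (map_poly f h).[y] == 0.
have [[P0 /andP[P0n0 P0y]]|tr] :=
  pselect (exists P, (P != 0) && root P); last first.
  have b0 : b != 0 by apply: contraNneq by0 => ->; rewrite rmorph0 horner0.
  (* Only [h = 0] kills a transcendental [y], so [w] need only avoid the roots of [b], whose image
     is nonzero once its leading coefficient survives. *)
  exists (lead_coef b); first by rewrite lead_coef_eq0.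
  move=> F phi Fclosed phib.
  have [|w bw] := @closed_field_nonroot F (map_poly phi b) Fclosed.
    by rewrite -lead_coef_eq0 lead_coef_map_eq.
  exists w; split=> // h hy; suff -> : h = 0 by rewrite rmorph0 horner0.
  apply/eqP; apply: contra_notT tr => h0; exists h.
  by rewrite h0; apply/eqP.
have exP : exists n, `[< exists2 P, (P != 0) && root P & size P = n >].
  by exists (size P0); apply/asboolP; exists P0 => //; rewrite P0n0.
case: (ex_minnP exP) => _ /asboolP[P /andP[Pn0 Py] <-] Pmin.
have {}Pmin h : h != 0 -> root h -> (size P <= size h)%N.
  by move=> h0 hy; apply: Pmin; apply/asboolP; exists h => //; rewrite h0.
(* Pseudo-division by [P]: the remainder also kills [y] and is shorter than [P], hence zero. The
   power of [lead_coef P] makes up for the missing inverses in [A]. *)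
have div h : root h ->
    (lead_coef P ^+ scalp h P *: h) = h %/ P * P.
  move=> hy; rewrite Pdiv.Idomain.divp_eq; suff -> : h %% P = 0 by rewrite addr0.
  apply/eqP; apply: contraT => r0; have := ltn_modpN0 h Pn0.
  rewrite ltnNge Pmin //; rewrite /root.
  have -> : h %% P = lead_coef P ^+ scalp h P *: h - h %/ P * P.
    by rewrite Pdiv.Idomain.divp_eq addrAC subrr add0r.
  rewrite rmorphB rmorphM /= map_polyZ hornerD hornerN hornerM hornerZ.
  by rewrite (eqP hy) (eqP Py) !mulr0 subrr.
have P1 : (1 < size P)%N.
  rewrite ltnNge; apply: contra Pn0 => /size1_polyC PC; move: Py.
  by rewrite /root PC map_polyC hornerC /= -(rmorph0 f) (inj_eq finj) polyC_eq0.
pose d := gcdp P b.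
have dP : d %| P := dvdp_gcdl P b.
have d0 : d != 0 by rewrite gcdp_eq0 negb_and Pn0.
(* If [d] killed [y], minimality would make it associate to [P]; then [P] would divide [b], and [b]
   would vanish at [y]. *)
have dy : ~~ root d.
  apply/negP => dy; have Pd : d %= P.
    by rewrite -(dvdp_size_eqp dP) eqn_leq dvdp_leq //= Pmin.
  have Pb : P %| b by rewrite -(eqp_dvdl _ Pd) dvdp_gcdr.
  move: (congr1 (fun q => (map_poly f q).[y]) (Pdiv.Idomain.divpK Pb)).
  rewrite rmorphM /= map_polyZ hornerM hornerZ (eqP Py) mulr0 => /esym/eqP.
  rewrite mulf_eq0 (negPf by0) orbF -(rmorph0 f) (inj_eq finj).
  by rewrite expf_eq0 lead_coef_eq0 (negPf Pn0) andbF.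
(* Since [d] does not kill [y], its cofactor in [P] does, and by minimality the cofactor is as long
   as [P]; so [d] is constant. *)
have d1 : size d = 1%N.
  have e := Pdiv.Idomain.divpK dP.
  have q0 : P %/ d != 0.
    apply: contraNneq Pn0 => q0; move/eqP: e; rewrite q0 mul0r eq_sym.
    rewrite scale_poly_eq0 expf_eq0 lead_coef_eq0 (negPf d0) andbF.
    by [].
  have qy : root (P %/ d).
    move: (congr1 (fun q => (map_poly f q).[y]) e).
    rewrite rmorphM /= map_polyZ hornerM hornerZ (eqP Py) mulr0 => /eqP.
    by rewrite mulf_eq0 => /orP[//|dy0]; case/negP: dy.
  have lc0 : lead_coef d ^+ scalp P d != 0.
    by rewrite expf_eq0 lead_coef_eq0 (negPf d0) andbF.
  have := Pmin _ q0 qy; rewrite -(size_scale P lc0) -e size_mul //.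
  rewrite -subn1 leq_subLR addnC leq_add2r => dle.
  by apply/eqP; rewrite eqn_leq dle size_poly_gt0.
have [[u v] /= uv] := Bezoutp P b.
have [c c0 uvc] : exists2 c, c != 0 & u * P + v * b = c%:P.
  by apply/size_poly1P; rewrite (eqp_size uv) -/d d1.
(* If [phi (lead_coef P)] is nonzero, [P] keeps its degree, so it has a root [w], and the factor in
   [div] can be cancelled. If [phi c] is nonzero, the Bezout identity forbids [b] to vanish at
   [w]. *)
exists (lead_coef P * c); first by rewrite mulf_neq0 // lead_coef_eq0.
move=> F phi Fclosed; rewrite rmorphM mulf_eq0 negb_or => /andP[phiP phic].
have [|w Pw] := @closed_field_root F (map_poly phi P) Fclosed.
  by rewrite size_map_poly_id0.
exists w; split=> [|h /eqP hy].
  move: (congr1 (fun q => (map_poly phi q).[w]) uvc).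
  rewrite rmorphD !rmorphM /= map_polyC hornerD !hornerM hornerC /= Pw mulr0 add0r.
  by move=> e; apply: contraNneq phic => bw; rewrite -e bw mulr0.
move: (congr1 (fun q => (map_poly phi q).[w]) (div h hy)).
rewrite rmorphM /= map_polyZ hornerM hornerZ Pw mulr0 rmorphXn /= => /eqP.
by rewrite mulf_eq0 expf_eq0 (negPf phiP) andbF /= => /eqP.
Qed.

(** The body of [finite_type] for a fixed list, on which induction is possible. *)
Definition generates (R S : comPzRingType) (f : {rmorphism R -> S}) (s : seq S) :=
  forall P : S -> Prop,
    (forall a, P (f a)) -> (forall y, y \in s -> P y) ->
    (forall y z, P y -> P z -> P (y + z)) ->
    (forall y z, P y -> P z -> P (y * z)) ->
    forall y, P y.

(* The generators are adjoined one at a time: A[y] is realised as the quotient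
   of {poly A} by the kernel of the evaluation at y. *)

Lemma generic_extension (B : idomainType) (s : seq B) (A : idomainType)
    (f : {rmorphism A -> B}) (b : B) :
  injective f -> generates f s -> b != 0 ->
  exists2 a, a != 0 & forall (F : fieldType) (phi : {rmorphism A -> F}),
    GRing.closed_field_axiom F -> phi a != 0 ->
    exists psi : {rmorphism B -> F}, (forall x, psi (f x) = phi x) /\ psi b != 0.
Proof.
elim: s A f b => [|y s IH] A f b finj fgen b0.
  (* Without generators [f] is onto, hence bijective, and [a] is the preimage of [b]. *)
  have fsurj c : exists a, f a = c.
    apply: (fgen (fun c => exists a, f a = c)) => //.
    - by move=> a; exists a.
    - by move=> _ _ [u <-] [v <-]; exists (u + v); rewrite rmorphD.
    - by move=> _ _ [u <-] [v <-]; exists (u * v); rewrite rmorphM.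
  have [a fa] := fsurj b; exists a.
    by apply: contraNneq b0 => a0; rewrite -fa a0 rmorph0.
  move=> F phi _ phia; have [|psi psiE] := @rmorphism_factor A B F f phi fsurj.
    by move=> c; rewrite -(rmorph0 f) => /finj ->; rewrite rmorph0.
  by exists psi; rewrite -fa psiE.
pose ev : {rmorphism {poly A} -> B} := horner_eval y \o map_poly f.
pose x := kernel_spec ev.
pose pi : {rmorphism {poly A} -> quotient_domain x} := proj_domain x.
have evE p : ev p = (map_poly f p).[y] by [].
have pi0 p : pi p = 0 -> ev p = 0.
  by move=> /eqP; rewrite proj_domain_eq0 inE => /eqP.
have [g gE] := @rmorphism_factor _ _ _ pi ev (@proj_domain_surj _ x) pi0.
have ginj : injective g.
  move=> u v; have [p <-] := proj_domain_surj u; have [q <-] := proj_domain_surj v.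
  move=> /eqP; rewrite -subr_eq0 -rmorphB -rmorphB gE => /eqP pq.
  apply/eqP; rewrite -subr_eq0 -rmorphB proj_domain_eq0 inE.
  exact/eqP.
have ggen : generates g s.
  move=> P Pg Ps PD PM; apply: fgen => //.
  - by move=> a; have := Pg (pi a%:P); rewrite gE evE map_polyC hornerC.
  - move=> z; rewrite inE => /orP[/eqP->|/Ps//].
    by have := Pg (pi 'X); rewrite gE evE map_polyX hornerX.
(* The induction hypothesis requires a nonzero value at [a'] in A[y]. A representative [p] of [a']
   is therefore the polynomial that [extend_step] has to keep nonzero at [w]. *)
have [a' a'0 ext'] := IH _ g b ginj ggen b0.
have [p pa'] := proj_domain_surj a'.
have py0 : (map_poly f p).[y] != 0.
  by apply: contraNneq a'0 => py; rewrite -pa' proj_domain_eq0 inE evE py.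
have [a a0 ext] := extend_step finj py0; exists a => // F phi Fclosed phia.
have [w [pw hw]] := ext F phi Fclosed phia.
(* By [hw], evaluation at [w] kills the kernel of [ev], so it descends to A[y]. *)
pose ew : {rmorphism {poly A} -> F} := horner_eval w \o map_poly phi.
have [|phi' phi'E] := @rmorphism_factor _ _ _ pi ew (@proj_domain_surj _ x).
  by move=> h /pi0 hy; exact: hw.
have [|psi [psiE psib]] := ext' F phi' Fclosed; first by rewrite -pa' phi'E.
exists psi; split=> // c; have := psiE (pi c%:P).
rewrite gE phi'E evE map_polyC hornerC => ->.
by rewrite /ew /= map_polyC /horner_eval hornerC.
Qed.


(** As [q] lies over the kernel p of [phi], the map S/p -> T/q is an injection of domains, again of
    finite type, to which [generic_extension] applies. *)
Lemma lift_point (S T : comPzRingType) (f : {rmorphism S -> T}) (F : fieldType)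
    (phi : {rmorphism S -> F}) (q : spec T) :
  finite_type f -> GRing.closed_field_axiom F -> spec_map f q = kernel_spec phi ->
  exists psi : {rmorphism T -> F}, forall a, psi (f a) = phi a.
Proof.
move=> [s fgen] Fclosed fq; pose p := kernel_spec phi.
pose piS : {rmorphism S -> quotient_domain p} := proj_domain p.
pose piT : {rmorphism T -> quotient_domain q} := proj_domain q.
have fK a : (f a \in (q : {pred T})) = (phi a == 0).
  by have := congr1 (fun x : spec S => a \in (x : {pred S})) fq; rewrite !inE.
have [|g gE] := @rmorphism_factor _ _ _ piS (rmorph_comp piT f) (@proj_domain_surj _ p).
  move=> a /eqP; rewrite proj_domain_eq0 inE -fK => fa.
  by apply/eqP; rewrite proj_domain_eq0.
have [|phi' phi'E] := @rmorphism_factor _ _ _ piS phi (@proj_domain_surj _ p).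
  by move=> a /eqP; rewrite proj_domain_eq0 inE => /eqP.
have ginj : injective g.
  move=> u v; have [a <-] := proj_domain_surj u; have [b <-] := proj_domain_surj v.
  move=> /eqP; rewrite -subr_eq0 -rmorphB -rmorphB gE /= proj_domain_eq0 fK => ab.
  by apply/eqP; rewrite -subr_eq0 -rmorphB proj_domain_eq0 inE.
have ggen : generates g [seq piT y | y <- s].
  move=> P Pg Ps PD PM z; have [t <-] := proj_domain_surj z.
  apply: (fgen (fun t => P (piT t))).
  - by move=> a; have := Pg (piS a); rewrite gE.
  - by move=> y ys; apply: Ps; exact: map_f.
  - by move=> u v; rewrite rmorphD; exact: PD.
  - by move=> u v; rewrite rmorphM; exact: PM.
(* No value has to be kept nonzero, so [b] is 1. The condition at [a] then holds because [phi']
   embeds S/p into [F]. *)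
have [a a0 ext] := generic_extension ginj ggen (oner_neq0 _).
have [|psi [psiE _]] := ext F phi' Fclosed.
  have [c ca] := proj_domain_surj a; move: a0; rewrite -ca phi'E.
  by rewrite proj_domain_eq0 inE.
exists (rmorph_comp psi piT) => c; have := psiE (piS c).
by rewrite gE phi'E.
Qed.

(** * Finitely generated subalgebras *)

(** Membership is a [Prop], since it will be an inductive predicate for [adjoin] and an existential
    one for [locally_image]; [subring_pred] is its boolean form. *)
Record subring (H : comPzRingType) := Subring {
  subring_prop :> H -> Prop;
  subring_prop1 : subring_prop 1;
  subring_propB : forall a b, subring_prop a -> subring_prop b -> subring_prop (a - b);
  subring_propM : forall a b, subring_prop a -> subring_prop b -> subring_prop (a * b) }.

Definition subring_pred (H : comPzRingType) (P : subring H) : {pred H} :=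
  fun h => `[< P h >].

Section SubringType.
Variables (H : comPzRingType) (P : subring H).

Lemma subring_predP : subring_closed (subring_pred P).
Proof.
split; first by apply/asboolP; exact: subring_prop1.
  by move=> a b /asboolP Pa /asboolP Pb; apply/asboolP; exact: subring_propB.
by move=> a b /asboolP Pa /asboolP Pb; apply/asboolP; exact: subring_propM.
Qed.

HB.instance Definition _ :=
  GRing.isSubringClosed.Build H (subring_pred P) subring_predP.

Record subring_type := SubringElt {
  subring_val : H;
  subring_valP : subring_val \in subring_pred P }.

HB.instance Definition _ := [isSub for subring_val].
HB.instance Definition _ := [Choice of subring_type by <:].
HB.instance Definition _ := 
  GRing.SubChoice_isSubComPzRing.Build H (subring_pred P) subring_type
    (subringClosedP _).

Definition subring_incl : {rmorphism subring_type -> H} := \val.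

Lemma subring_inclP x : P (subring_incl x).
Proof. by apply/asboolP; exact: subring_valP. Qed.

Lemma subring_incl_inj : injective subring_incl.
Proof. exact: val_inj. Qed.

Lemma subring_corestrict (A : comPzRingType) (f : {rmorphism A -> H}) :
  (forall a, P (f a)) ->
  {g : {rmorphism A -> subring_type} | forall a, subring_incl (g a) = f a}.
Proof.
move=> Pf; pose g a := SubringElt (introT (asboolP _) (Pf a) : f a \in subring_pred P).
have gB : zmod_morphism g.
  by move=> a b; apply: subring_incl_inj; rewrite rmorphB /= rmorphB.
have gM : monoid_morphism g.
  split; first by apply: subring_incl_inj; rewrite rmorph1 /= rmorph1.
  by move=> a b; apply: subring_incl_inj; rewrite rmorphM /= rmorphM.
pose gz := GRing.isZmodMorphism.Build _ _ _ gB.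
pose gm := GRing.isMonoidMorphism.Build _ _ _ gM.
pose G : {rmorphism A -> subring_type} := HB.pack g gz gm.
by exists G.
Qed.

End SubringType.

Section Adjoin.
Variables (R H : comPzRingType) (u : {rmorphism R -> H}) (s : seq H).

(** The constructors mirror the closure conditions of [finite_type]. Opposites are products with the
    image of -1. *)
Inductive adjoin_prop : H -> Prop :=
| AdjoinBase a : adjoin_prop (u a)
| AdjoinGen y : y \in s -> adjoin_prop y
| AdjoinAdd y z : adjoin_prop y -> adjoin_prop z -> adjoin_prop (y + z)
| AdjoinMul y z : adjoin_prop y -> adjoin_prop z -> adjoin_prop (y * z).

Lemma adjoin_prop1 : adjoin_prop 1.
Proof. by rewrite -(rmorph1 u); exact: AdjoinBase. Qed.

Lemma adjoin_propB y z : adjoin_prop y -> adjoin_prop z -> adjoin_prop (y - z).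
Proof.
move=> hy hz; apply: AdjoinAdd => //; rewrite -mulN1r -(rmorph1 u) -rmorphN.
by apply: AdjoinMul => //; exact: AdjoinBase.
Qed.

Definition adjoin : subring H := Subring adjoin_prop1 adjoin_propB AdjoinMul.

Definition adjoin_str : {rmorphism R -> subring_type adjoin} :=
  sval (@subring_corestrict H adjoin R u AdjoinBase).

Lemma adjoin_strE a : subring_incl adjoin (adjoin_str a) = u a.
Proof. exact: (svalP (@subring_corestrict H adjoin R u AdjoinBase)). Qed.

Lemma adjoin_finite_type : finite_type adjoin_str.
Proof.
exists (pmap insub s) => P Pu Ps PD PM y.
(* The induction runs over derivations of membership in [H], so the element of the subring type is
   generalised along with its value. *)
suff: forall h, adjoin h -> forall x, subring_incl adjoin x = h -> P x.
  by move/(_ _ (subring_inclP y) y); exact.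
move=> h; elim=> {h} [a|h hs|h k ah Ph ak Pk|h k ah Ph ak Pk] x xh.
- suff -> : x = adjoin_str a by exact: Pu.
  by apply: subring_incl_inj; rewrite adjoin_strE.
- by apply: Ps; rewrite mem_pmap; apply/mapP; exists h; rewrite // -xh valK.
- have hA : h \in subring_pred adjoin by apply/asboolP.
  have kA : k \in subring_pred adjoin by apply/asboolP.
  suff -> : x = SubringElt hA + SubringElt kA by apply: PD; [exact: Ph | exact: Pk].
  by apply: subring_incl_inj; rewrite rmorphD.
- have hA : h \in subring_pred adjoin by apply/asboolP.
  have kA : k \in subring_pred adjoin by apply/asboolP.
  suff -> : x = SubringElt hA * SubringElt kA by apply: PM; [exact: Ph | exact: Pk].
  by apply: subring_incl_inj; rewrite rmorphM.
Qed.

End Adjoin.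

Section Hull.
Variables (R : comPzRingType) (Z : ralg R).

Definition hull (s : seq Z) : TX R :=
  exist _ (Alg (adjoin_str (alg_str Z) s)) (adjoin_finite_type (alg_str Z) s).

Definition hull_incl (s : seq Z) : alg_hom (sval (hull s)) Z :=
  @AlgHom R (sval (hull s)) Z (subring_incl (adjoin (alg_str Z) s))
    (adjoin_strE (alg_str Z) s).

Lemma hull_incl_inj s : injective (hull_incl s).
Proof. exact: subring_incl_inj. Qed.

Lemma hull_incl_surj s h : h \in s -> exists x, hull_incl s x = h.
Proof.
move=> hs; have hA : h \in subring_pred (adjoin (alg_str Z) s).
  by apply/asboolP; exact: AdjoinGen.
by exists (SubringElt hA).
Qed.

(** The images of generators of [U] form [s0]. Allowing every larger list lets several points factor
    through one common hull. *)
Lemma hull_factor (U : TX R) (e : alg_hom (sval U) Z) :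
  exists s0 : seq Z, forall s, {subset s0 <= s} ->
    exists g : alg_hom (sval U) (sval (hull s)), alg_comp (hull_incl s) g = e.
Proof.
case: (svalP U) => t tgen; exists [seq e y | y <- t] => s ts.
have es a : adjoin (alg_str Z) s (e a).
  apply: (tgen (fun a => adjoin (alg_str Z) s (e a))).
  - by move=> r; rewrite alg_fun_str; exact: AdjoinBase.
  - by move=> y yt; apply: AdjoinGen; apply: ts; exact: map_f.
  - by move=> y z hy hz; rewrite rmorphD; exact: AdjoinAdd.
  - by move=> y z hy hz; rewrite rmorphM; exact: AdjoinMul.
have [g gE] := subring_corestrict es.
have gstr a : g (alg_str (sval U) a) = alg_str (sval (hull s)) a.
  apply: hull_incl_inj; rewrite alg_fun_str.
  by apply: etrans (gE _) _; rewrite alg_fun_str.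
exists (@AlgHom R (sval U) (sval (hull s)) g gstr).
by apply: alg_hom_ext => a; exact: gE.
Qed.

Lemma hull_factor2 (U V : TX R) (e : alg_hom (sval U) Z) (e' : alg_hom (sval V) Z) :
  exists (s : seq Z) (g : alg_hom (sval U) (sval (hull s)))
      (g' : alg_hom (sval V) (sval (hull s))),
    alg_comp (hull_incl s) g = e /\ alg_comp (hull_incl s) g' = e'.
Proof.
have [s f] := hull_factor e; have [s' f'] := hull_factor e'.
have [|g gE] := f (s ++ s'); first by move=> z zs; rewrite mem_cat zs.
have [|g' gE'] := f' (s ++ s'); first by move=> z zs; rewrite mem_cat zs orbT.
by exists (s ++ s'), g, g'.
Qed.

End Hull.

(** * Presheaves and the sheaf of functions on points *)

Section ProdProj.
Variables (I : Type) (A : I -> comPzRingType) (i : I).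

Definition prod_proj_fun (f : prod_ring A) : A i := f i.

Lemma prod_proj_zmod : zmod_morphism prod_proj_fun.
Proof. by []. Qed.

Lemma prod_proj_monoid : monoid_morphism prod_proj_fun.
Proof. by []. Qed.

HB.instance Definition _ :=
  GRing.isZmodMorphism.Build (prod_ring A) (A i) prod_proj_fun prod_proj_zmod.
HB.instance Definition _ :=
  GRing.isMonoidMorphism.Build (prod_ring A) (A i) prod_proj_fun prod_proj_monoid.

Definition prod_proj : {rmorphism prod_ring A -> A i} := prod_proj_fun.

End ProdProj.

Section SheafCondition.
Variable R : comPzRingType.

(** This is [is_sheaf] with the functor unbundled into rings and restriction maps. *)
Definition sheaf_condition (P : TX R -> comPzRingType)
    (p : forall U V : TX R, mor V U -> {rmorphism P U -> P V}) :=
  forall (U V : TX R) (f : mor V U), surj_cover f ->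
  forall t : P V,
    (forall (W : TX R) (g h : mor W V), f \oc g = f \oc h -> p _ _ g t = p _ _ h t) ->
    exists! s : P U, p _ _ f s = t.

End SheafCondition.

Section Points.
Variables (R : comPzRingType) (Z : ralg R).

Definition point (U : TX R) := alg_hom (sval U) Z.

Definition point_comp (U V : TX R) (f : mor V U) (e : point V) : point U :=
  alg_comp e (f : alg_hom (sval U) (sval V)).

(** Geometrically, every morphism from the spectrum of [Z] to [U] lifts along every cover of [U]. *)
Definition covers_split := forall (U V : TX R) (f : mor V U), surj_cover f ->
  forall e : point U, exists e' : point V, point_comp f e' = e.

Definition points_ring (U : TX R) : comPzRingType :=
  prod_ring (fun _ : point U => Z : comPzRingType).

Definition points_restr (U V : TX R) (f : mor V U) :
  {rmorphism points_ring U -> points_ring V} :=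
  prod_map (fun e : point V =>
    prod_proj (fun _ : point U => Z : comPzRingType) (point_comp f e)).

Lemma points_restr1 (U : TX R) : points_restr (idm U) = rmorph_id (points_ring U).
Proof.
apply: rmorphism_ext => t; apply: functional_extensionality_dep => e.
by congr (t _); apply: alg_hom_ext.
Qed.

Lemma points_restrM (U V W : TX R) (f : mor V U) (g : mor W V) :
  points_restr (f \oc g) = rmorph_comp (points_restr g) (points_restr f).
Proof.
apply: rmorphism_ext => t; apply: functional_extensionality_dep => e.
by congr (t _); apply: alg_hom_ext.
Qed.

Definition points_eval_fun (U : TX R) : {rmorphism ring_of U -> points_ring U} :=
  prod_map (fun e : point U => alg_fun e).

Lemma points_eval_nat (U V : TX R) (f : mor V U) s :
  points_restr f (points_eval_fun U s) = points_eval_fun V (comorphism f s).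
Proof. exact: functional_extensionality_dep. Qed.

(** The hull of the images of [e] and [e'] plays the role of the fibre product. The two composites
    to [U] agree there because they agree in [Z], into which the hull injects. *)
Lemma point_refine (U V V' : TX R) (f : mor V U) (f' : mor V' U)
    (e : point V) (e' : point V') :
  point_comp f e = point_comp f' e' ->
  exists (W : TX R) (d : point W) (g : mor W V) (g' : mor W V'),
    [/\ point_comp g d = e, point_comp g' d = e' & f \oc g = f' \oc g'].
Proof.
move=> ee'; have [s [g [g' [ge ge']]]] := hull_factor2 e e'.
exists (hull s), (hull_incl s), g, g'; split=> //.
apply: alg_hom_ext => a; apply: (@hull_incl_inj _ _ s).
have := congr1 (fun h : point U => h a) ee'.
by rewrite -ge -ge'.
Qed.

Lemma points_sheaf : covers_split -> sheaf_condition points_restr.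
Proof.
move=> split_covers U V f fcov t tcompat.
(* The value at [e] is read off at any lift of [e] to [V]; compatibility of [t] on a common
   refinement makes it independent of the lift. *)
pose s : points_ring U := fun e => t (sval (cid (split_covers U V f fcov e))).
exists s; split.
  apply: functional_extensionality_dep => e /=; rewrite /prod_fun /= /prod_proj_fun /s.
  case: cid => e' /= ee'; have [W [d [g [g' [ge ge' gg']]]]] := point_refine ee'.
  have := congr1 (fun x : points_ring W => x d) (tcompat W g' g (esym gg')).
  rewrite /= /prod_fun /= /prod_proj_fun /=.
  by rewrite ge ge'.
move=> s' s'f; apply: functional_extensionality_dep => e; rewrite /s.
by case: cid => e' /= <-; rewrite -s'f.
Qed.

End Points.

Section PresheafFacts.
Variable R : comPzRingType.

Definition sections (P : presheaf R) (U : TX R) : comPzRingType := fobj P U.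

Definition restriction (P : presheaf R) (U V : TX R) (f : mor V U) :
  {rmorphism sections P U -> sections P V} := fmap P f.

Definition nat_app (P Q : presheaf R) (u : nat_trans P Q) (U : TX R) :
  {rmorphism sections P U -> sections Q U} := u U.

Lemma restriction1 (P : presheaf R) (U : TX R) :
  restriction P (idm U) = rmorph_id (sections P U).
Proof. exact: (fmap1 P U). Qed.

Lemma restrictionM (P : presheaf R) (U V W : TX R) (f : mor V U) (g : mor W V) :
  restriction P (f \oc g) = rmorph_comp (restriction P g) (restriction P f).
Proof. exact: (@fmapM _ _ P U V W g f). Qed.

Lemma nat_app_restriction (P Q : presheaf R) (u : nat_trans P Q)
    (U V : TX R) (f : mor V U) :
  rmorph_comp (restriction Q f) (nat_app u U) =
  rmorph_comp (nat_app u V) (restriction P f).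
Proof. exact: (ntc_nat u (f : @mor (opposite (TX R)) U V)). Qed.

Lemma restriction1E (P : presheaf R) (U : TX R) s : restriction P (idm U) s = s.
Proof. by rewrite restriction1. Qed.

Lemma restrictionME (P : presheaf R) (U V W : TX R) (f : mor V U) (g : mor W V) s :
  restriction P (f \oc g) s = restriction P g (restriction P f s).
Proof. by rewrite restrictionM. Qed.

Lemma nat_app_restrictionE (P Q : presheaf R) (u : nat_trans P Q)
    (U V : TX R) (f : mor V U) s :
  restriction Q f (nat_app u U s) = nat_app u V (restriction P f s).
Proof.
exact: (congr1 (fun h : {rmorphism sections P U -> sections Q V} => h s)
  (nat_app_restriction u f)).
Qed.

Section MakePresheaf.
Variables (S : TX R -> comPzRingType).
Variable p : forall U V : TX R, mor V U -> {rmorphism S U -> S V}.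
Hypothesis p1 : forall U, p (idm U) = rmorph_id (S U).
Hypothesis pM : forall (U V W : TX R) (f : mor V U) (g : mor W V),
  p (f \oc g) = rmorph_comp (p g) (p f).

Definition make_presheaf : presheaf R :=
  @Functor (opposite (TX R)) CRing S (fun U V f => p f)
    p1 (fun U V W g f => pM f g).

Lemma make_presheaf_sheaf : sheaf_condition p -> is_sheaf make_presheaf.
Proof. exact. Qed.

End MakePresheaf.

Lemma sheaf_condition_of (P : presheaf R) : is_sheaf P -> sheaf_condition (restriction P).
Proof. exact. Qed.

Section MakeNat.
Variables (P Q : presheaf R) (u : forall U, {rmorphism sections P U -> sections Q U}).
Hypothesis u_nat : forall (U V : TX R) (f : mor V U) s,
  restriction Q f (u U s) = u V (restriction P f s).

Lemma make_nat_subproof (U V : TX R) (f : mor V U) :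
  rmorph_comp (restriction Q f) (u U) = rmorph_comp (u V) (restriction P f).
Proof. by apply: rmorphism_ext => s; exact: u_nat. Qed.

Definition make_nat : nat_trans P Q :=
  @NatTrans (opposite (TX R)) CRing P Q u make_nat_subproof.

End MakeNat.

End PresheafFacts.

(** * Local image of the structure presheaf, and germs *)

Section LocalImage.
Variables (R : comPzRingType) (Z : ralg R) (O : TX R -> comPzRingType).
Variable r : forall U V : TX R, mor V U -> {rmorphism O U -> O V}.
Hypothesis r1 : forall U s, r (idm U) s = s.
Hypothesis rM : forall (U V W : TX R) (f : mor V U) (g : mor W V) s,
  r (f \oc g) s = r g (r f s).
Variable eta : forall U : TX R, {rmorphism ring_of U -> O U}.
Hypothesis etaE : forall (U V : TX R) (f : mor V U) s,
  r f (eta U s) = eta V (comorphism f s).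

Definition locally_image_prop (U : TX R) (t : O U) : Prop :=
  forall e : point Z U, exists (W : TX R) (d : point Z W) (g : mor W U)
    (s : ring_of W), point_comp g d = e /\ r g t = eta W s.

(** A common neighbourhood of [e] for two sections lets their difference and product be computed in
    one ring of the structure presheaf. *)
Lemma locally_image2 (U : TX R) (t t' : O U) :
  locally_image_prop t -> locally_image_prop t' ->
  forall e : point Z U, exists (W : TX R) (d : point Z W) (g : mor W U)
    (s s' : ring_of W), [/\ point_comp g d = e, r g t = eta W s
      & r g t' = eta W s'].
Proof.
move=> tloc tloc' e; have [V [d [f [s [fd ts]]]]] := tloc e.
have [V' [d' [f' [s' [fd' ts']]]]] := tloc' e.
have [|W [c [g [g' [gc gc' fg]]]]] := @point_refine _ _ _ _ _ f f' d d'.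
  by rewrite fd fd'.
exists W, c, (f \oc g), (comorphism g s), (comorphism g' s'); split.
- by rewrite -fd -gc; apply: alg_hom_ext.
- by rewrite rM ts etaE.
- by rewrite fg rM ts' etaE.
Qed.

Lemma locally_image1 U : locally_image_prop (1 : O U).
Proof.
move=> e; exists U, e, (idm U), 1; rewrite r1 rmorph1; split=> //.
exact: alg_hom_ext.
Qed.

Lemma locally_imageB U (t t' : O U) :
  locally_image_prop t -> locally_image_prop t' -> locally_image_prop (t - t').
Proof.
move=> tl tl' e; have [W [d [g [s [s' [gd ts ts']]]]]] := locally_image2 tl tl' e.
by exists W, d, g, (s - s'); rewrite !rmorphB ts ts'.
Qed.

Lemma locally_imageM U (t t' : O U) :
  locally_image_prop t -> locally_image_prop t' -> locally_image_prop (t * t').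
Proof.
move=> tl tl' e; have [W [d [g [s [s' [gd ts ts']]]]]] := locally_image2 tl tl' e.
by exists W, d, g, (s * s'); rewrite !rmorphM ts ts'.
Qed.

Definition locally_image (U : TX R) : subring (O U) :=
  Subring (@locally_image1 U) (@locally_imageB U) (@locally_imageM U).

Lemma locally_image_restr (U V : TX R) (f : mor V U) (t : O U) :
  locally_image U t -> locally_image V (r f t).
Proof.
move=> tl e; have [W' [d' [f' [s [fd' ts]]]]] := tl (point_comp f e).
have [W [c [g [g' [gc gc' fg]]]]] := point_refine fd'.
exists W, c, g', (comorphism g s); split=> //.
by rewrite -rM -fg rM ts etaE.
Qed.

Lemma locally_image_eta (U : TX R) (s : ring_of U) :
  locally_image U (eta U s).
Proof.
move=> e; exists U, e, (idm U), s; rewrite r1; split=> //.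
exact: alg_hom_ext.
Qed.

Definition image_ring (U : TX R) : comPzRingType := subring_type (locally_image U).

Definition image_incl (U : TX R) : {rmorphism image_ring U -> (O U)} :=
  subring_incl (locally_image U).

Lemma image_incl_inj U : injective (image_incl U).
Proof. exact: subring_incl_inj. Qed.

Lemma image_restr_subproof (U V : TX R) (f : mor V U) (t : image_ring U) :
  locally_image V (rmorph_comp (r f) (image_incl U) t).
Proof. by apply: locally_image_restr; exact: subring_inclP. Qed.

Definition image_restr (U V : TX R) (f : mor V U) :
    {rmorphism image_ring U -> image_ring V} :=
  sval (subring_corestrict (image_restr_subproof f)).

Lemma image_restrE (U V : TX R) (f : mor V U) t :
  image_incl V (image_restr f t) = r f (image_incl U t).
Proof. exact: (svalP (subring_corestrict (image_restr_subproof f))). Qed.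

Lemma image_restr1 U : image_restr (idm U) = rmorph_id (image_ring U).
Proof.
apply: rmorphism_ext => t; apply: image_incl_inj.
by rewrite image_restrE r1.
Qed.

Lemma image_restrM (U V W : TX R) (f : mor V U) (g : mor W V) :
  image_restr (f \oc g) = rmorph_comp (image_restr g) (image_restr f).
Proof.
apply: rmorphism_ext => t; apply: image_incl_inj.
by rewrite image_restrE rM -!image_restrE.
Qed.

Definition image_eta_fun (U : TX R) : {rmorphism ring_of U -> image_ring U} :=
  sval (@subring_corestrict _ (locally_image U) _ (eta U) (@locally_image_eta U)).

Lemma image_eta_funE (U : TX R) (s : ring_of U) :
  image_incl U (image_eta_fun U s) = eta U s.
Proof.
exact: (svalP
  (@subring_corestrict _ (locally_image U) _ (eta U) (@locally_image_eta U))).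
Qed.

Lemma image_eta_nat (U V : TX R) (f : mor V U) s :
  image_restr f (image_eta_fun U s) = image_eta_fun V (comorphism f s).
Proof. by apply: image_incl_inj; rewrite image_restrE !image_eta_funE etaE. Qed.

Hypothesis split_covers : covers_split Z.

Lemma image_sheaf : sheaf_condition r -> sheaf_condition image_restr.
Proof.
move=> Osheaf U V f fcov t tcompat.
have [|s [sf suniq]] := Osheaf U V f fcov (image_incl V t).
  by move=> W g h fgh; rewrite -!image_restrE; rewrite (tcompat W g h fgh).
(* A neighbourhood of [e] for [s] is a neighbourhood for [t] of some lift of [e] to [V]. *)
have sloc : locally_image U s.
  move=> e; have [e' e'e] := split_covers fcov e.
  have [W [d [g [s' [gd ts]]]]] := subring_inclP t e'.
  exists W, d, (f \oc g), s'; split; first by rewrite -e'e -gd; apply: alg_hom_ext.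
  by rewrite rM sf.
exists (SubringElt (introT (asboolP _) sloc)); split.
  by apply: image_incl_inj; apply: etrans (image_restrE _ _) _.
move=> s' s't; apply: image_incl_inj; apply: suniq.
by rewrite -s't; apply: esym (image_restrE _ _).
Qed.


End LocalImage.

Section Stalk.
Variables (R : comPzRingType) (Z : ralg R) (O : TX R -> comPzRingType).
Variable r : forall U V : TX R, mor V U -> {rmorphism O U -> O V}.
Variable eta : forall U : TX R, {rmorphism ring_of U -> O U}.
Hypothesis etaE : forall (U V : TX R) (f : mor V U) s,
  r f (eta U s) = eta V (comorphism f s).
Variable germ : forall U : TX R, point Z U -> {rmorphism O U -> Z}.
Hypothesis germ_r : forall (U V : TX R) (f : mor V U) (e : point Z V) (t : O U),
  germ e (r f t) = germ (point_comp f e) t.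
Hypothesis germ_eta : forall (U : TX R) (e : point Z U) (s : ring_of U),
  germ e (eta U s) = e s.
Hypothesis eta_loc : forall (U : TX R) (t : O U), locally_image_prop Z r eta t.

Lemma germ_surj (z : Z) : exists (U : TX R) (e : point Z U) (s : ring_of U),
  germ e (eta U s) = z.
Proof.
have [x xz] := @hull_incl_surj R Z [:: z] z (mem_head _ _).
by exists (hull [:: z]), (hull_incl [:: z]), x; rewrite germ_eta.
Qed.

(** The existence half of the universal property of the stalk. Each [z] is a section over the hull
    it generates, and this prescribes [h z]. *)
Lemma germ_colimit (C : comPzRingType)
    (q : forall U : TX R, point Z U -> {rmorphism O U -> C}) :
  (forall (U V : TX R) (f : mor V U) (e : point Z V) (t : O U),
     q _ e (r f t) = q _ (point_comp f e) t) ->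
  exists h : {rmorphism Z -> C}, forall (U : TX R) (e : point Z U) (t : O U),
    h (germ e t) = q _ e t.
Proof.
move=> q_r.
pose x z := sval (cid (@hull_incl_surj R Z [:: z] z (mem_head _ _))).
have xE z : hull_incl [:: z] (x z) = z by rewrite /x; case: cid.
pose h z := q _ (hull_incl [:: z]) (eta _ (x z)).
(* Independence of the neighbourhood: [s] over [U] and the chosen section over the hull of [e s]
   become equal in a hull receiving both. *)
have hE (U : TX R) (e : point Z U) (s : ring_of U) : h (e s) = q _ e (eta U s).
  have [t [g [g' [ge ge']]]] := hull_factor2 e (hull_incl [:: e s]).
  have pt (V : TX R) (d : point Z V) (k : alg_hom (sval V) (sval (hull t))) y :
      alg_comp (hull_incl t) k = d -> hull_incl t (k y) = d y by move=> <-.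
  have gs : g s = g' (x (e s)).
    apply: (@hull_incl_inj _ _ t).
    by rewrite (pt _ _ _ _ ge) (pt _ _ _ _ ge') xE.
  have qg (V : TX R) (d : point Z V) (k : alg_hom (sval V) (sval (hull t))) y :
      alg_comp (hull_incl t) k = d ->
      q _ d (eta V y) = q _ (hull_incl t) (eta (hull t) (k y)).
    by move=> <-; rewrite -(etaE (k : mor (hull t) V) y) q_r.
  by rewrite /h (qg _ _ _ _ ge) (qg _ _ _ _ ge') gs.
(* Sums and products are compared inside one hull containing both elements. *)
have pair (z z' : Z) : exists (U : TX R) (e : point Z U) (s s' : ring_of U),
    e s = z /\ e s' = z'.
  have [s sz] := @hull_incl_surj R Z [:: z; z'] z (mem_head _ _).
  have [|s' sz'] := @hull_incl_surj R Z [:: z; z'] z'; first by rewrite !inE eqxx orbT.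
  by exists (hull [:: z; z']), (hull_incl [:: z; z']), s, s'.
have hB : zmod_morphism h.
  move=> z z'; have [U [e [s [s' [<- <-]]]]] := pair z z'.
  by rewrite -rmorphB !hE !rmorphB.
have hM : monoid_morphism h.
  split=> [|z z'].
    by have [U [e [s [s' _]]]] := pair 0 0; rewrite -(rmorph1 e) hE !rmorph1.
  have [U [e [s [s' [<- <-]]]]] := pair z z'.
  by rewrite -rmorphM !hE !rmorphM.
pose hz := GRing.isZmodMorphism.Build _ _ _ hB.
pose hm := GRing.isMonoidMorphism.Build _ _ _ hM.
pose H : {rmorphism Z -> C} := HB.pack h hz hm.
(* Near [e] the section [t] comes from the structure presheaf, where [hE] applies. *)
exists H => U e t; have [W [d [g [s [gd ts]]]]] := eta_loc t e.
rewrite -gd -germ_r -q_r ts germ_eta; exact: hE.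
Qed.

End Stalk.

(** * The fixation as an absolute filter *)

Lemma final_fmap (L C : category) (F : functor L C) (t t' : L) :
  is_final t -> is_final t' -> is_final (F t) -> is_final (F t').
Proof.
move=> tf tf' Ftf a; have [g _] := tf t'; have [g' _] := tf' t.
have [k [_ kuniq]] := Ftf a.
have gg' : g' \oc g = idm t'.
  by have [i [_ iuniq]] := tf' t'; exact: etrans (esym (iuniq _ I)) (iuniq _ I).
exists (fmap F g' \oc k); split=> // f _.
by rewrite (kuniq (fmap F g \oc f) I) cmpA -fmapM gg' fmap1 cmp1m.
Qed.

Section Fixation.
Variables (R : comPzRingType) (Z : ralg R).

Local Notation L := (fixation_index (Z : AffX R)).
Local Notation F := (fixation (Z : AffX R)).

Definition fix_obj (U : TX R) (e : point Z U) : L :=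
  @Under _ _ (full_incl (fun S : AffX R => finite_type (alg_str S))) Z U e.

Definition fix_point (l : L) : point Z (F l) :=
  under_map l.

Definition fix_mor (l l' : L)
    (f : mor (F l) (F l')) :
  point_comp f (fix_point l) = fix_point l' -> mor l l'.
Proof. by move=> fe; exists f. Defined.

Lemma fix_mor_comp (l l' : L) (f : mor l l') :
  point_comp (sval f) (fix_point l) = fix_point l'.
Proof. exact: (svalP f). Qed.

Lemma baseX_final : is_final (baseX R).
Proof.
move=> U; exists (to_baseX U); split=> // f _; apply: alg_hom_ext => a.
exact: esym (alg_fun_str (f : alg_hom (Alg (rmorph_id R)) (sval U)) a).
Qed.

Definition fix_base : L :=
  @fix_obj (baseX R) (@AlgHom R (Alg (rmorph_id R)) Z (alg_str Z) (fun=> erefl)).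

Lemma fix_base_final : is_final fix_base.
Proof.
move=> l; have [f [_ funiq]] := baseX_final (F l).
have fe : point_comp (f : mor (F l) (F fix_base))
    (fix_point l) = fix_point fix_base.
  apply: alg_hom_ext => a.
  rewrite /= -(alg_fun_str (fix_point l)).
  by rewrite (alg_fun_str (f : alg_hom (Alg (rmorph_id R)) (sval (F l)))).
exists (fix_mor fe); split=> // g _; apply: under_hom_inj; exact: funiq.
Qed.

(** Final objects are isomorphic, so it suffices to inspect [fix_base], which lies over the final
    object [baseX]. *)
Lemma fixation_respects_final : respects_final F.
Proof.
move=> t tf.
by apply: final_fmap tf _; [exact: fix_base_final | exact: baseX_final].
Qed.

Lemma fixation_filter : is_filter F.
Proof.
split; last exact: fixation_respects_final.
split; first split; first by exists fix_base; exact: fix_base_final.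
- move=> l l' m f f'.
  have ff' : point_comp (sval f) (fix_point l) = point_comp (sval f') (fix_point l').
    by rewrite !fix_mor_comp.
  have [W [d [g [g' [ge ge' gg']]]]] := point_refine ff'.
  exists (fix_obj d), (@fix_mor (fix_obj d) l g ge), (@fix_mor (fix_obj d) l' g' ge').
  exact: under_hom_inj.
(* Both arrows induce the point of [m] in [Z]; passing to the hull of the image of [l], which embeds
   into [Z], therefore equalizes them. *)
- move=> l m f f'; have [t0 factor] := hull_factor (fix_point l).
  have [g ge] := factor t0 (fun z zt => zt).
  exists (fix_obj (hull_incl t0)).
  exists (@fix_mor (fix_obj (hull_incl t0)) l (g : mor (hull t0) (under_obj l)) ge).
  apply: under_hom_inj; apply: alg_hom_ext => a; apply: (@hull_incl_inj _ _ t0).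
  have pt y : hull_incl t0 (g y) = fix_point l y.
    exact: (congr1 (fun d : point Z (under_obj l) => d y) ge).
  apply: etrans (pt _) _; apply: etrans _ (esym (pt _)).
  have ff' := etrans (fix_mor_comp f) (esym (fix_mor_comp f')).
  exact: (congr1 (fun d : point Z (under_obj m) => d a) ff').
Qed.

(** A lift of the point of [l] to [Y] turns [Y] itself into an object of the index category. *)
Lemma fixation_absolute : covers_split Z ->
  (forall l : L, surj_cover (to_baseX (F l))) ->
  is_absolute F.
Proof.
move=> split_covers covers; split=> // l Y f fcov.
have [e ee] := split_covers _ _ f fcov (fix_point l).
by exists (fix_obj e), (idm Y), (@fix_mor (fix_obj e) l f ee); rewrite cmpm1.
Qed.

End Fixation.

(** * The absolute stalk *)

Section PresheafCocone.
Variables (J T C : category) (F : functor J T) (P : functor (opposite T) C).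

(** The condition [leg_compat] with the opposite categories unfolded. *)
Definition compatible (c : C) (k : forall j : J, mor (P (F j)) c) :=
  forall (i j : J) (f : mor i j), k i \oc @fmap (opposite T) C P _ _ (fmap F f) = k j.

Lemma cocone_compatible (c : C)
    (q : cocone (functor_comp P (opposite_functor F)) c) :
  compatible (fun j : J => leg q (j : opposite J)).
Proof. by move=> i j f; exact: (leg_compat q (f : @mor (opposite J) j i)). Qed.

Definition make_cocone (c : C) (k : forall j : J, mor (P (F j)) c)
    (kP : compatible k) : cocone (functor_comp P (opposite_functor F)) c :=
  @Cocone _ _ (functor_comp P (opposite_functor F)) c k (fun j i f => kP i j f).

Lemma make_cocone_colimit (c : C) (k : forall j : J, mor (P (F j)) c)
    (kP : compatible k) :
  (forall (d : C) (q : forall j : J, mor (P (F j)) d), compatible q ->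
    exists! h : mor c d, forall j : J, h \oc k j = q j) ->
  is_colimit (make_cocone kP).
Proof. by move=> univ d q; exact: (univ d _ (cocone_compatible q)). Qed.

End PresheafCocone.

(** * Points with values in rad(R) *)

Section RadPoints.
Variables (R : comPzRingType) (K : forall x : spec R, alg_closure (residue_field x)).
Let Z : ralg R := Alg (radR_map K).

Lemma radR_map_eq0 (x : spec R) (a : R) :
  (radR_map K a x == 0) = (a \in (x : {pred R})).
Proof. 
exact: etrans (fmorph_eq0 (acl_map (K x)) (residue_map x a))
  (etrans (tofrac_eq0 _) (proj_domain_eq0 x a)).
 Qed.

Definition rad_coord (U : TX R) (e : point Z U) (x : spec R) :
    {rmorphism ring_of U -> K x} :=
  rmorph_comp (prod_proj (fun x : spec R => K x : comPzRingType) x) (alg_fun e).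

Lemma rad_covers_split : covers_split Z.
Proof.
move=> U V f [ffin fsurj] e.
have lift (x : spec R) : {psi : {rmorphism ring_of V -> K x} |
    forall a, psi (comorphism f a) = rad_coord e x a}.
  apply: cid; have [q fq] := fsurj (kernel_spec (rad_coord e x)).
  exact: (lift_point ffin (@acl_closed _ (K x)) fq).
(* A map into a product is a family of maps, so the lifts are chosen independently at each prime.
   Extending [e] makes the result a map over [R]. *)
pose e' : {rmorphism ring_of V -> radR K} := prod_map (fun x => sval (lift x)).
have e'f a : e' (comorphism f a) = e a.
  by apply: functional_extensionality_dep => x; exact: (svalP (lift x)).
have e'str a : e' (alg_str (sval V) a) = alg_str Z a.
  rewrite -(alg_fun_str (e : alg_hom (sval U) Z)) -e'f; congr (e' _).
  exact: esym (alg_fun_str (f : alg_hom (sval U) (sval V)) a).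
exists (@AlgHom R (sval V) Z e' e'str).
by apply: alg_hom_ext => a; exact: e'f.
Qed.

(** A prime [x] of [R] is the contraction of the kernel of the coordinate of [e] at [x], because R
    -> K_x has kernel [x]. *)
Lemma rad_point_cover (U : TX R) (e : point Z U) : surj_cover (to_baseX U).
Proof.
split=> [|x]; first exact: (svalP U).
exists (kernel_spec (rad_coord e x)); apply: spec_ext => a.
rewrite !inE -radR_map_eq0; congr (_ == 0).
exact: (congr1 (fun h : radR K => h x) (alg_fun_str e a)).
Qed.

End RadPoints.

(** * The universal property of the sheafification, and the stalk *)

Section Universal.
Variables (R : comPzRingType) (O : presheaf R).
Variable eta : nat_trans (structure_presheaf R) O.
Hypothesis eta_sheafification : is_sheafification eta.

Definition eta_at (U : TX R) : {rmorphism ring_of U -> sections O U} := nat_app eta U.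

Lemma eta_at_restriction (U V : TX R) (f : mor V U) s :
  restriction O f (eta_at U s) = eta_at V (comorphism f s).
Proof. exact: (nat_app_restrictionE eta f s). Qed.

Lemma sheafification_sheaf : sheaf_condition (restriction O).
Proof. exact: (sheaf_condition_of (proj1 eta_sheafification)). Qed.

Lemma sheafification_factor_nat (G : presheaf R)
    (u : nat_trans (structure_presheaf R) G) : is_sheaf G ->
  exists v : nat_trans O G, forall U s, nat_app v U (nat_app eta U s) = nat_app u U s.
Proof. move=> Gsheaf; exact: (proj1 (proj2 eta_sheafification G u Gsheaf)). Qed.

Lemma sheafification_unique_nat (v w : nat_trans O O) :
  (forall U s, nat_app v U (nat_app eta U s) = nat_app w U (nat_app eta U s)) ->
  forall U s, nat_app v U s = nat_app w U s.
Proof.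
exact: (proj2 (proj2 eta_sheafification O eta (proj1 eta_sheafification)) v w).
Qed.

Lemma sheafification_factor (S : TX R -> comPzRingType)
    (p : forall U V : TX R, mor V U -> {rmorphism S U -> S V})
    (u : forall U : TX R, {rmorphism ring_of U -> S U}) :
  (forall U, p _ _ (idm U) = rmorph_id (S U)) ->
  (forall (U V W : TX R) (f : mor V U) (g : mor W V),
    p _ _ (f \oc g) = rmorph_comp (p _ _ g) (p _ _ f)) ->
  sheaf_condition p ->
  (forall (U V : TX R) (f : mor V U) s, p _ _ f (u U s) = u V (comorphism f s)) ->
  exists v : forall U : TX R, {rmorphism sections O U -> S U},
    (forall (U V : TX R) (f : mor V U) t, p _ _ f (v U t) = v V (restriction O f t)) /\
    forall U s, v U (eta_at U s) = u U s.
Proof.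
move=> p1 pM psheaf u_nat.
pose G := make_presheaf p1 pM.
have [v vE] := sheafification_factor_nat
  (@make_nat R (structure_presheaf R) G u u_nat)
  (@make_presheaf_sheaf R S p p1 pM psheaf).
exists (nat_app v); split; [exact: (nat_app_restrictionE v) | exact: vE].
Qed.

(** Uniqueness is applied with [O] itself as the target sheaf and the identity as the second map. *)
Lemma sheafification_unique
    (w : forall U : TX R, {rmorphism sections O U -> sections O U}) :
  (forall (U V : TX R) (f : mor V U) t,
    restriction O f (w U t) = w V (restriction O f t)) ->
  (forall U s, w U (eta_at U s) = eta_at U s) ->
  forall U t, w U t = t.
Proof.
move=> w_nat wE.
pose idO U := rmorph_id (sections O U).
have idO_nat (U V : TX R) (f : mor V U) t :
    restriction O f (idO U t) = idO V (restriction O f t) by [].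
exact: (sheafification_unique_nat (v := make_nat w_nat) (w := make_nat idO_nat) wE).
Qed.

End Universal.

Section AbsoluteStalk.
Variables (R : comPzRingType) (Z : ralg R) (O : presheaf R).
Variable eta : nat_trans (structure_presheaf R) O.
Hypothesis split_covers : covers_split Z.
Hypothesis eta_sheafification : is_sheafification eta.

(** The composite [w] of the factorization through [image_ring] with the inclusion fixes the image
    of [eta], so it is the identity and the inclusion is onto. *)
Lemma eta_locally_image (U : TX R) (t : sections O U) :
  locally_image_prop Z (restriction O) (eta_at eta) t.
Proof.
pose r1 := @restriction1E R O; pose rM := @restrictionME R O.
pose rE := eta_at_restriction eta.
have [v [v_nat vE]] := sheafification_factor eta_sheafification
  (image_restr1 Z r1 rM rE) (image_restrM Z r1 rM rE)
  (image_sheaf split_covers (sheafification_sheaf eta_sheafification))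
  (image_eta_nat Z r1 rM rE).
pose w V := rmorph_comp (image_incl Z r1 rM rE V) (v V).
have w_nat (V W : TX R) (f : mor W V) s :
    restriction O f (w V s) = w W (restriction O f s).
  by apply: etrans (esym (image_restrE _ _)) _; rewrite v_nat.
have wE V s : w V (eta_at eta V s) = eta_at eta V s.
  by apply: etrans (image_eta_funE Z r1 rM rE s); rewrite -vE.
rewrite -(sheafification_unique eta_sheafification w_nat wE t).
exact: (@subring_inclP _ (locally_image Z r1 rM rE U) (v U t)).
Qed.

Lemma exists_germ :
  exists germ : forall U : TX R, point Z U -> {rmorphism sections O U -> Z},
  (forall (U V : TX R) (f : mor V U) (e : point Z V) (t : sections O U),
     germ V e (restriction O f t) = germ U (point_comp f e) t) /\
  (forall (U : TX R) (e : point Z U) (s : ring_of U), germ U e (eta_at eta U s) = e s).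
Proof.
have [v [v_nat vE]] := sheafification_factor eta_sheafification
  (points_restr1 Z) (@points_restrM R Z) (points_sheaf split_covers)
  (@points_eval_nat R Z).
exists (fun U e =>
  rmorph_comp (prod_proj (fun _ : point Z U => Z : comPzRingType) e) (v U)).
split=> [U V f e t|U e s].
  exact: (congr1 (fun x : points_ring Z V => x e) (esym (v_nat U V f t))).
exact: (congr1 (fun x : points_ring Z U => x e) (vE U s)).
Qed.

Local Notation L := (fixation_index (Z : AffX R)).
Local Notation F := (fixation (Z : AffX R)).

Lemma fixation_stalk :
  exists p : cocone (stalk_diagram F O) (Z : comPzRingType),
    is_stalk p /\
    forall (l : L) (s : ring_of (F l)),
      stalk_map p l (component eta (F l) s) = fixation_map l s.
Proof.
have [germ [germ_r germ_eta]] := exists_germ.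
pose k (l : L) :
    @mor CRing (O (F l)) (Z : comPzRingType) :=
  germ (F l) (fix_point l).
have kP : compatible k.
  move=> l m f; apply: rmorphism_ext => t.
  apply: etrans (germ_r _ _ (sval f) (fix_point l) t) _.
  by rewrite fix_mor_comp.
exists (make_cocone kP); split=> [|l s]; last exact: (germ_eta _ (fix_point l) s).
apply: make_cocone_colimit => C q qP.
pose qpt (U : TX R) (e : point Z U) :
    {rmorphism sections O U -> (C : comPzRingType)} :=
  q (fix_obj e).
have qpt_r (U V : TX R) (f : mor V U) (e : point Z V) (t : sections O U) :
    qpt V e (restriction O f t) = qpt U (point_comp f e) t.
  pose a := @fix_mor R Z (fix_obj e) (fix_obj (point_comp f e)) f erefl.
  exact: (congr1 (fun k : {rmorphism sections O U -> (C : comPzRingType)} => k t)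
    (qP _ _ a)).
have [h hE] := germ_colimit (eta_at_restriction eta) germ_r germ_eta
  eta_locally_image qpt_r.
exists h; split=> [l|h' h'q].
  by apply: rmorphism_ext => t; case: l t => U e t; exact: hE.
(* Uniqueness: every element of [Z] is the germ of a section coming from [eta]. *)
apply: rmorphism_ext => z; have [U [e [s <-]]] := germ_surj germ_eta z.
rewrite hE.
exact: (congr1 (fun k : {rmorphism sections O U -> (C : comPzRingType)} =>
  k (eta_at eta U s))
  (esym (h'q (fix_obj e)))).
Qed.

End AbsoluteStalk.

Theorem proposition3p5p1 (R : comPzRingType)
    (K : forall x : spec R, alg_closure (residue_field x))
    (O_surj : presheaf R) (eta : nat_trans (structure_presheaf R) O_surj) :
  is_sheafification eta ->
  let Z : AffX R := Alg (radR_map K) in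
  let F := fixation Z in
  [/\ is_filter F, is_absolute F &
      exists p : cocone (stalk_diagram F O_surj) (radR K),
        is_stalk p /\
        forall (l : fixation_index Z) (s : ring_of (F l)),
          stalk_map p l (component eta (F l) s) = fixation_map l s].
Proof.
move=> eta_sheafification Z F; split.
- exact: (@fixation_filter R Z).
- apply: (@fixation_absolute R Z (@rad_covers_split R K)) => l.
  exact: (rad_point_cover (fix_point l)).
- exact: (@fixation_stalk R Z O_surj eta (@rad_covers_split R K) eta_sheafification).
Qed.
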